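(* Let $p = 2$ and let $q$ be an odd prime number. Then the Wiener index of the line graph $L(\Gamma(\mathbb{Z}_{2q}))$ is $W(L(\Gamma(\mathbb{Z}_{2q}))) = \dfrac{(q-1)(q-2)}{2}$.
   Context: For a positive integer $n$, $\mathbb{Z}_n$ is the ring of residue classes modulo $n$. The zero-divisor graph $\Gamma(\mathbb{Z}_n)$ is the simple undirected graph whose vertices are the nonzero zero-divisors of $\mathbb{Z}_n$ (nonzero $x \in \mathbb{Z}_n$ such that $xy = 0$ for some nonzero $y \in \mathbb{Z}_n$), with distinct vertices $x,y$ adjacent if and only if $xy=0$. The line graph $L(\Gamma(\mathbb{Z}_n))$ is the graph whose vertices are the edges of $\Gamma(\mathbb{Z}_n)$, two distinct vertices being adjacent if the corresponding edges share a common vertex in $\Gamma(\mathbb{Z}_n)$. The Wiener index of a finite connected graph $G$ with vertex set $V$ is $W(G) = \frac{1}{2}\sum_{x,y \in V} d(x,y)$, the sum being over all ordered pairs $(x,y)$, where $d(x,y)$ is the length of a shortest path between $x$ and $y$. *)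

(* Defs.v *)
From HB Require Import structures.
From mathcomp Require Import all_boot all_order all_algebra.

Set Implicit Arguments.
Unset Strict Implicit.
Unset Printing Implicit Defensive.

Import GRing.Theory.
Local Open Scope ring_scope.

Record sgraph := SGraph {
  vertex :> finType;
  adj : rel vertex;
  adj_sym : symmetric adj;
  adj_irrefl : irreflexive adj
}.

Section Distance.
Variable G : sgraph.

Definition walk (k : nat) (x y : G) : bool :=
  [exists s : k.-tuple G, path (@adj G) x s && (last x s == y)].

Lemma connect_walk (x y : G) :
  connect (@adj G) x y -> exists k, walk k x y.
Proof.
case/connectP=> s path_s ->; exists (size s).
by apply/existsP; exists (in_tuple s); rewrite path_s eqxx.
Qed.

(* The value 0 when x and y lie in different components is a dummy. *)
Definition dist (x y : G) : nat :=
  match @idP (connect (@adj G) x y) with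
  | ReflectT xy => ex_minn (connect_walk xy)
  | ReflectF _ => 0
  end.

Definition wiener : rat := 2^-1 * \sum_(x : G) \sum_(y : G) (dist x y)%:R.

End Distance.

Section LineGraph.
Variable G : sgraph.

(* An edge is the unordered pair of its end points. *)
Definition is_edge (e : {set G}) : bool :=
  [exists x : G, exists y : G, adj x y && (e == [set x; y])].

Definition line_adj : rel {e : {set G} | is_edge e} :=
  fun e f => (e != f) && (val e :&: val f != set0).

Lemma line_adj_sym : symmetric line_adj.
Proof. by move=> e f; rewrite /line_adj eq_sym setIC. Qed.

Lemma line_adj_irrefl : irreflexive line_adj.
Proof. by move=> e; rewrite /line_adj eqxx. Qed.

Definition line_graph : sgraph := SGraph line_adj_sym line_adj_irrefl.

End LineGraph.

Section ZeroDivisorGraph.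
Variable R : finComNzRingType.

Definition nz_zero_divisor (x : R) : bool :=
  (x != 0) && [exists y : R, (y != 0) && (x * y == 0)].

Definition zdg_adj : rel {x : R | nz_zero_divisor x} :=
  fun x y => (x != y) && (val x * val y == 0).

Lemma zdg_adj_sym : symmetric zdg_adj.
Proof. by move=> x y; rewrite /zdg_adj eq_sym mulrC. Qed.

Lemma zdg_adj_irrefl : irreflexive zdg_adj.
Proof. by move=> x; rewrite /zdg_adj eqxx. Qed.

Definition zero_divisor_graph : sgraph := SGraph zdg_adj_sym zdg_adj_irrefl.

End ZeroDivisorGraph.

(* Main.v *)
(** The nonzero zero divisors of Z_2q are q and the nonzero even residues, and
    two distinct ones multiply to zero exactly when one of them is q.  So the
    zero-divisor graph is a star with q - 1 edges, and its line graph is the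
    complete graph on q - 1 vertices. *)

Require Import Defs.
From mathcomp Require Import all_boot all_order all_algebra.
From mathcomp Require Import zify ring.

Set Implicit Arguments.
Unset Strict Implicit.
Unset Printing Implicit Defensive.

Import GRing.Theory.
Local Open Scope ring_scope.

Lemma dist_leq_walk (G : sgraph) (k : nat) (x y : G) :
  walk k x y -> (dist x y <= k)%N.
Proof.
rewrite /dist => xy_k.
(* The branch of [dist] carries the connectedness proof, hence the case analysis on [idP] itself;
   the dummy value 0 satisfies the bound trivially. *)
by case: {-}_ / idP => // xy; case: ex_minnP => m _ /(_ _ xy_k).
Qed.

Lemma dist_refl (G : sgraph) (x : G) : dist x x = 0%N.
Proof.
apply/eqP; rewrite -leqn0; apply: dist_leq_walk.
by apply/existsP; exists [tuple]; rewrite /= eqxx.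
Qed.

Lemma dist_adj (G : sgraph) (x y : G) : adj x y -> dist x y = 1%N.
Proof.
move=> xy; apply/eqP; rewrite eqn_leq dist_leq_walk /=; last first.
  by apply/existsP; exists [tuple y]; rewrite /= xy eqxx.
rewrite /dist; case: {-}_ / idP => [xy'|]; last by case; apply: connect1.
(* A walk of length 0 would make [x] equal to [y], against irreflexivity. *)
case: ex_minnP => -[|m] // /existsP[s].
rewrite tuple0 /= => /eqP exy _.
by rewrite exy adj_irrefl in xy.
Qed.

(** Each row of the distance matrix has one 0, on the diagonal, and 1 everywhere else. *)
Lemma wiener_complete (G : sgraph) :
  (forall x y : G, x != y -> adj x y) ->
  wiener G = #|G|%:R * (#|G|%:R - 1) / 2.
Proof.
move=> complete; rewrite /wiener.
have row (x : G) : \sum_(y : G) (dist x y)%:R = #|G|%:R - 1 :> rat.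
  rewrite (bigD1 x) //= dist_refl add0r.
  rewrite (eq_bigr (fun=> 1)); last first.
    by move=> y yx; rewrite dist_adj // complete // eq_sym.
  rewrite sumr_const cardC1 -subn1 natrB //.
  by apply/card_gt0P; exists x.
rewrite (eq_bigr _ (fun x _ => row x)) sumr_const.
by rewrite -[X in _ * X]mulr_natl mulrC.
Qed.

Section Star.

Variables (G : sgraph) (c : G).
Hypothesis star : forall x y : G, adj x y = (x != y) && ((x == c) || (y == c)).

(** Every edge contains the centre [c], so it is determined by its other end point. *)
Lemma star_is_edge (e : {set G}) :
  is_edge e = (e \in [set [set c; x] | x in predC1 c]).
Proof.
apply/existsP/imsetP => [[x /existsP[y /andP[]]]|[x]].
  rewrite star => /andP[xy /orP[] /eqP xc] /eqP->.
    by exists y; rewrite -?xc // inE eq_sym.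
  by exists x; rewrite -?xc // setUC.
rewrite inE => xc ->; exists c; apply/existsP; exists x.
by rewrite star eq_sym xc !eqxx.
Qed.

Lemma star_line_adj (e f : line_graph G) : e != f -> adj e f.
Proof.
move=> ef; rewrite /= /line_adj ef /=; apply/set0Pn; exists c.
have inc (g : line_graph G) : c \in val g.
  by have /= := valP g; rewrite star_is_edge => /imsetP[x _ ->]; rewrite !inE eqxx.
by rewrite inE !inc.
Qed.

Lemma card_star_line : #|line_graph G| = #|G|.-1.
Proof.
rewrite card_sig -(cardC1 c) (eq_card star_is_edge) card_in_imset // => x y.
(* Membership of [x] in [[set c; y]] with [x != c] forces [x = y]. *)
rewrite !inE => xc yc /setP/(_ x).
by rewrite !inE eqxx (negPf xc) /= => /esym/eqP.
Qed.

End Star.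

Section ZeroDivisors.

Variable q : nat.
Hypotheses (q_prime : prime q) (q_odd : odd q).

Local Notation Z2q := 'Z_(2 * q).

Let q_gt2 : (2 < q)%N.
Proof. exact: odd_prime_gt2. Qed.

Let cast2q : (Zp_trunc (2 * q)).+2 = (2 * q)%N.
Proof. by apply: Zp_cast; lia. Qed.

Let modn_cast (m : nat) : (m %% (Zp_trunc (2 * q)).+2 = m %% (2 * q))%N.
Proof. by rewrite cast2q. Qed.

Lemma Z2q_lt (x : Z2q) : (x < 2 * q)%N.
Proof. by rewrite -[ltnRHS]cast2q. Qed.

Lemma Z2q_neq0 (x : Z2q) : (x != 0) = (0 < x)%N.
Proof. by rewrite lt0n. Qed.

Lemma dvdn_2q (m : nat) : (2 * q %| m)%N = ~~ odd m && (q %| m)%N.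
Proof. by rewrite Gauss_dvd ?dvdn2 // coprime2n. Qed.

(** Divisibility of the product by [2 * q] splits into a parity condition and, as [q] is prime,
    divisibility of one factor by [q]. *)
Lemma Z2q_mul_eq0 (x y : Z2q) :
  (x * y == 0) = ~~ (odd x && odd y) && ((q %| x)%N || (q %| y)%N).
Proof.
by rewrite -val_eqE /= modn_cast -/(dvdn _ _) dvdn_2q oddM Euclid_dvdM.
Qed.

Lemma dvdn_lt_2q (m : nat) : (0 < m < 2 * q)%N -> (q %| m)%N -> m = q.
Proof.
move=> m_bd /dvdnP[k mE]; move: m_bd; rewrite mE.
by case: k {mE} => [|[|k]]; rewrite ?mul1n //; nia.
Qed.

Lemma Z2q_dvd (x : Z2q) : x != 0 -> (q %| x)%N = (x == q :> nat).
Proof.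
rewrite Z2q_neq0 => x0; apply/idP/eqP => [|->//].
by apply: dvdn_lt_2q; rewrite x0 Z2q_lt.
Qed.

Lemma Z2q_val (m : nat) : (m < 2 * q)%N -> (inZp m : Z2q) = m :> nat.
Proof. by move=> m_lt; rewrite /= modn_cast modn_small. Qed.

Lemma nz_zero_divisor_2q (x : Z2q) :
  nz_zero_divisor x = (x != 0) && ((x == q :> nat) || ~~ odd x).
Proof.
rewrite /nz_zero_divisor; case x0: (x != 0) => //=.
apply/existsP/idP => [[y /andP[y0]]|].
  rewrite Z2q_mul_eq0 !Z2q_dvd // => /andP[par /orP[->//|/eqP yq]].
  (* Since [y = q] is odd, the parity condition makes [x] even. *)
  by move: par; rewrite yq q_odd andbT orbC => ->.
have val2 := @Z2q_val 2 ltac:(lia); have valq := @Z2q_val q ltac:(lia).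
(* The residue 2 annihilates [q], and [q] annihilates every even residue. *)
case/orP=> [/eqP xq|x_even]; [exists (inZp 2)|exists (inZp q)].
  by rewrite Z2q_neq0 Z2q_mul_eq0 val2 xq dvdnn andbF.
by rewrite Z2q_neq0 Z2q_mul_eq0 valq (negPf x_even) dvdnn orbT andbT; lia.
Qed.

Lemma card_zero_divisors_2q : #|zero_divisor_graph Z2q| = q.
Proof.
(* The vertices are enumerated by ['I_q]: positive indices give the nonzero even residues, and the
   free index 0 is sent to [q]. *)
pose f (i : 'I_q) : Z2q := inZp (if i == 0%N :> nat then q else i.*2).
have fE i : f i = (if i == 0%N :> nat then q else i.*2) :> nat.
  by apply: Z2q_val; case: ifP => _; have := ltn_ord i; lia.
have f_inj : injective f.
  move=> i j /(congr1 (@nat_of_ord _)); rewrite !fE => ij; apply: val_inj.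
  by move: ij => /=; do 2 case: ifP; lia.
rewrite card_sig -[RHS]card_ord -(card_codom f_inj); apply: eq_card => x.
rewrite !inE nz_zero_divisor_2q Z2q_neq0; apply/idP/codomP => [|[i ->]].
  have x_lt := Z2q_lt x.
  case/andP=> x0 /orP[/eqP xq|x_even].
    have i_lt : (0 < q)%N by lia.
    by exists (Ordinal i_lt); apply: val_inj; rewrite [RHS]fE /=.
  have i_lt : (x./2 < q)%N by lia.
  by exists (Ordinal i_lt); apply: val_inj; rewrite [RHS]fE /=; case: ifP; lia.
by rewrite !fE; case: ifP; rewrite ?eqxx ?odd_double; lia.
Qed.

Lemma zero_divisor_graph_2q_star :
  exists c : zero_divisor_graph Z2q, forall x y : zero_divisor_graph Z2q,
    adj x y = (x != y) && ((x == c) || (y == c)).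
Proof.
have valq := @Z2q_val q ltac:(lia).
have c_zd : nz_zero_divisor (inZp q : Z2q).
  by rewrite nz_zero_divisor_2q Z2q_neq0 valq eqxx andbT; lia.
exists (Sub (inZp q) c_zd) => x y; rewrite /= /zdg_adj.
case xy: (x != y) => //=.
have vtx (z : zero_divisor_graph Z2q) :
    [/\ (q %| val z)%N = (val z == q :> nat),
        (z == Sub (inZp q) c_zd) = (val z == q :> nat)
      & (val z == q :> nat) || ~~ odd (val z)].
  have := valP z; rewrite /= nz_zero_divisor_2q => /andP[z0 zq].
  by split=> //; [rewrite Z2q_dvd | rewrite -[X in _ = (_ == X)]valq].
have [xd xc xq] := vtx x; have [yd yc yq] := vtx y.
rewrite Z2q_mul_eq0 xd yd xc yc.
(* Distinct vertices are not both the centre; so if one is [q], the other is even and the parity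
   condition holds automatically. *)
have : ~~ ((val x == q :> nat) && (val y == q :> nat)).
  rewrite -xc -yc; apply/negP => /andP[/eqP xE /eqP yE].
  by rewrite xE yE eqxx in xy.
by move: xq yq => /=; do 2 case: (_ == q :> nat); do 2 case: odd.
Qed.

End ZeroDivisors.

Unset Implicit Arguments.

Theorem theorem3p5 (q : nat) (hq : prime q) (hodd : odd q) :
  wiener (line_graph (zero_divisor_graph 'Z_(2 * q))) =
  (q%:R - 1) * (q%:R - 2) / 2 :> rat.
Proof.
have [c star] := zero_divisor_graph_2q_star hq hodd.
rewrite wiener_complete; last exact: star_line_adj star.
rewrite (card_star_line star) card_zero_divisors_2q // -subn1.
by rewrite natrB ?prime_gt0 //; ring.
Qed.
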